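(* Let $n\ge 1$. For any starting permutation $\pi\in S_n$, two or fewer iterations of the map $r:S_n\to S_n$ result in a permutation lying in a cycle of $r$ of length at most two; that is, there is $k\in\{0,1,2\}$ such that $\rho=r^k(\pi)$ satisfies $r^m(\rho)=\rho$ for some $m\in\{1,2\}$.
   Context: $S_n$ is the set of permutations of $1,2,\ldots,n$, written as words $\pi=\pi_1,\ldots,\pi_n$. A Young diagram of a partition $\lambda=(\lambda_1\ge\cdots\ge\lambda_k>0)$ of $n$ is drawn in French notation: left-justified rows, with $\lambda_i$ boxes in the $i$-th row from the bottom. A standard Young tableau (SYT) of shape $\lambda$ is a filling of the boxes with $1,\ldots,n$, each used once, with rows increasing left to right and columns increasing bottom to top. RSK: for $\pi\in S_n$, $\mathrm{RSK}(\pi)=(S,T)$, where $S$ (the insertion tableau) is obtained by starting from the empty tableau and inserting $\pi_1,\pi_2,\ldots,\pi_n$ in order. To insert $a$ into a row (starting with the bottom row): if $a$ is larger than every entry of the row, place $a$ at the end of the row and stop; otherwise $a$ replaces the leftmost entry $b$ of the row that is greater than $a$, and $b$ is then inserted into the next row up by the same rule. The recording tableau $T$ has the same shape as $S$, with the box that is newly created when inserting $\pi_i$ labeled $i$. RSK is a bijection from $S_n$ to pairs of SYT of size $n$ of the same shape. The reading word of an SYT is the permutation obtained by concatenating its rows from the top row to the bottom row, each read left to right. The reversed reading word is the reading word written in reverse order (right to left). The map $r:S_n\to S_n$ is defined by: if $\mathrm{RSK}(\pi)=(S,T)$, then $r(\pi)$ is the reversed reading word of $T$. The $k$-fold iterate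 of $r$ is written $r^k$. A cycle of length $m$ (an $m$-cycle) of a map $g:A\to A$ is a sequence $a,g(a),g^2(a),\ldots,g^m(a)$ with $g^m(a)=a$ and $m\ge1$ minimal with this property. *)

(* Defs.v *)
From mathcomp Require Import all_boot.
Set Implicit Arguments.
Unset Strict Implicit.
Unset Printing Implicit Defensive.

(* A word w = [:: pi_1; ...; pi_n] listing 1, ..., n, each exactly once. *)
Definition permword (n : nat) := {w : seq nat | perm_eq w (iota 1 n)}.

(* Tableaux are sequences of rows, bottom row first (French notation). *)
Definition tableau := seq (seq nat).

(* The second component is the bumped entry, if any. *)
Definition row_insert (a : nat) (row : seq nat) : seq nat * option nat :=
  let j := find (fun b => a < b) row in
  if j < size row then (set_nth 0 row j a, Some (nth 0 row j))
  else (rcons row a, None).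

(* The second component is the index (from the bottom, starting at 0) of the
   row which gains a box; the new box is at the right end of that row. *)
Fixpoint tab_insert (a : nat) (S : tableau) : tableau * nat :=
  if S is row :: S' then
    match row_insert a row with
    | (row', None) => (row' :: S', 0)
    | (row', Some b) => let: (S'', k) := tab_insert b S' in (row' :: S'', k.+1)
    end
  else ([:: [:: a]], 0).

(* When k = size T, this starts a new top row. *)
Definition add_box (T : tableau) (k i : nat) : tableau :=
  set_nth [::] T k (rcons (nth [::] T k) i).

(* ia = (i, pi_i) *)
Definition RSK_step (ST : tableau * tableau) (ia : nat * nat) :
    tableau * tableau :=
  let: (S', k) := tab_insert ia.2 ST.1 in (S', add_box ST.2 k ia.1).

Definition RSK (w : seq nat) : tableau * tableau :=
  foldl RSK_step ([::], [::]) (zip (iota 1 (size w)) w).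

Definition reading_word (T : tableau) : seq nat := flatten (rev T).

Definition reversed_reading_word (T : tableau) : seq nat :=
  rev (reading_word T).

Lemma perm_add_box T k i : perm_eq (flatten (add_box T k i)) (i :: flatten T).
Proof.
rewrite /add_box; elim: T k => [|row T IHT] [|k] //=.
- by elim: k.
- by rewrite -cats1 -catA /= perm_catC /= perm_cons perm_catC.
- rewrite (perm_trans (perm_cat (perm_refl row) (IHT k))) //.
  by rewrite perm_catC /= perm_cons perm_catC.
Qed.

Lemma perm_RSK w : perm_eq (flatten (RSK w).2) (iota 1 (size w)).
Proof.
have step s ST : perm_eq (flatten (foldl RSK_step ST s).2)
                         (flatten ST.2 ++ unzip1 s).
  elim: s ST => [|ia s IHs] ST /=; first by rewrite cats0.
  rewrite (perm_trans (IHs _)) // /RSK_step.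
  case: (tab_insert _ _) => S' k /=.
  rewrite (perm_trans (perm_cat (perm_add_box _ _ _) (perm_refl _))) //.
  by rewrite /= -cat_cons -cat1s -catA perm_catCA.
by rewrite (perm_trans (step _ _)) //= unzip1_zip // size_iota.
Qed.

Lemma perm_reversed_reading_word T :
  perm_eq (reversed_reading_word T) (flatten T).
Proof.
by rewrite /reversed_reading_word perm_rev perm_flatten // perm_rev.
Qed.

Lemma r_subproof n (pi : permword n) :
  perm_eq (reversed_reading_word (RSK (val pi)).2) (iota 1 n).
Proof.
rewrite (perm_trans (perm_reversed_reading_word _)) //.
by have := perm_RSK (val pi); rewrite (perm_size (valP pi)) size_iota.
Qed.

Definition r (n : nat) (pi : permword n) : permword n :=
  exist _ (reversed_reading_word (RSK (val pi)).2) (r_subproof pi).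

(* a, g a, ..., g^m a is an m-cycle of g. *)
Definition in_cycle (A : Type) (g : A -> A) (m : nat) (a : A) : Prop :=
  [/\ 0 < m, iter m g a = a & forall j, 0 < j < m -> iter j g a <> a].

(* Main.v *)
(** Write [w T] for the reversed reading word of a standard tableau [T] of
    shape [la].  It lists the rows of [T] from the bottom up, each in decreasing
    order.  When such a row is inserted, every letter bumps the previous
    ones up by one row along a new last column; so the insertion tableau is
    the transpose of [T], and the recording tableau is the transpose of the
    tableau of shape [la] filled row by row with 1, 2, 3, etc.  It depends on
    [la] only and has the conjugate shape.  Hence [r^2 pi] depends only on the
    shape of the recording tableau of [pi], and [r^4 pi = r^2 pi]. *)
Require Import Defs.
From mathcomp Require Import all_boot.

(** * Partitions *)

(** Both sides say that the box in row [i] and column [j] lies in the diagram of [la]: as the parts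
    decrease weakly, the rows that reach column [j] are the first ones. *)
Lemma count_ltn_partition (la : seq nat) i j :
  sorted geq la -> (i < count (ltn j) la) = (j < nth 0 la i).
Proof.
elim: la i => [|x la IHla] i /= s_la; first by rewrite nth_nil !ltn0.
have x_max : all (geq x) la.
  by apply: order_path_min s_la => a b c /= ba cb; apply: leq_trans cb ba.
case: (ltnP j x) => jx.
  by case: i => [|i] //=; rewrite add1n ltnS IHla ?(path_sorted s_la).
have -> : count (ltn j) la = 0.
  apply/eqP; rewrite -leqn0 leqNgt -has_count; apply/hasPn => y.
  by move=> /(allP x_max) /= yx; rewrite -leqNgt (leq_trans yx).
rewrite ltn0; case: i => [|i] /=; first by rewrite ltnNge jx.
apply/esym/negbTE; rewrite -leqNgt (leq_trans _ jx) //.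
have [il|il] := ltnP i (size la); first by apply: (allP x_max); rewrite mem_nth.
by rewrite nth_default.
Qed.

(** Trailing zeros would be invisible to [nth 0]; once they are excluded, the positive values also
    determine the length. *)
Lemma eq_partition (la mu : seq nat) :
    0 \notin la -> 0 \notin mu ->
  (forall i j, (j < nth 0 la i) = (j < nth 0 mu i)) -> la = mu.
Proof.
move=> la0 mu0 eq_lamu.
have pos (s : seq nat) i : 0 \notin s -> (0 < nth 0 s i) = (i < size s).
  move=> s0; have [lt_is|?] := ltnP i (size s); last by rewrite nth_default.
  by rewrite lt0n; apply: contraNneq s0 => <-; rewrite mem_nth.
have eq_nth_lamu i : nth 0 la i = nth 0 mu i.
  apply/eqP; rewrite eqn_leq (leqNgt (nth 0 la i)) (leqNgt (nth 0 mu i)).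
  by rewrite eq_lamu ltnn -eq_lamu ltnn.
apply: (@eq_from_nth _ 0) => [|i _]; last exact: eq_nth_lamu.
apply/eqP; case: ltngtP => //; rewrite -pos //.
  by rewrite -eq_nth_lamu nth_default.
by rewrite eq_nth_lamu nth_default.
Qed.

(** Conjugation is an involution: a box [(i, j)] of [nu] is a box [(j, i)] of [mu], hence a box
    [(i, j)] of [la]. *)
Lemma conjugate_partitionK (la mu nu : seq nat) :
    sorted geq la -> 0 \notin la -> sorted geq mu -> 0 \notin nu ->
    (forall i, nth 0 mu i = count (ltn i) la) ->
    (forall i, nth 0 nu i = count (ltn i) mu) ->
  nu = la.
Proof.
move=> s_la la0 s_mu nu0 eq_mu eq_nu; apply: eq_partition => // i j.
by rewrite eq_nu count_ltn_partition // eq_mu count_ltn_partition.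
Qed.

(** * Columns of tableaux *)

Lemma nth_shape (T : tableau) p : nth 0 (shape T) p = size (nth [::] T p).
Proof.
have [pT|?] := ltnP p (size T); first by rewrite (nth_map [::]).
by rewrite !nth_default ?size_map.
Qed.

Definition dominates (R R' : seq nat) : Prop :=
  size R' <= size R /\ forall j, j < size R' -> nth 0 R j < nth 0 R' j.

(** Above the top row [nth] yields empty rows, which every row dominates, so [i] can be left
    unbounded. *)
Definition column_strict (T : tableau) : Prop :=
  forall i, dominates (nth [::] T i) (nth [::] T i.+1).

Lemma column_strict_cons R T :
  column_strict (R :: T) <-> dominates R (head [::] T) /\ column_strict T.
Proof.
split=> [cT|[dR cT] [|i]]; [|by rewrite /= nth0|exact: cT].
by split=> [|i]; [rewrite -nth0; apply: (cT 0)|apply: (cT i.+1)].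
Qed.

Lemma shape_column_strict T : column_strict T -> sorted geq (shape T).
Proof.
move=> cT; apply/(sortedP 0) => i; rewrite size_map => iT /=.
by rewrite !(nth_map [::]) ?(ltnW iT) //; case: (cT i).
Qed.

(** * Insertion *)

(** When no entry exceeds [a], [find] returns [size R] and [set_nth] appends, so one formula covers
    both outcomes of [row_insert]. *)
Definition insert_row (a : nat) (R : seq nat) : seq nat :=
  set_nth 0 R (find (ltn a) R) a.

Lemma insert_row_cons a x R :
  insert_row a (x :: R) = if a < x then a :: R else x :: insert_row a R.
Proof. by rewrite /insert_row /=; case: (a < x). Qed.

Lemma insert_row_max a R : ~~ has (ltn a) R -> insert_row a R = rcons R a.
Proof.
elim: R => // x R IHR; rewrite insert_row_cons rcons_cons /=.
by case: ifP => // _ /IHR ->.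
Qed.

Lemma row_insertE a R : row_insert a R =
  (insert_row a R,
   if has (ltn a) R then Some (nth 0 R (find (ltn a) R)) else None).
Proof.
rewrite has_find /row_insert -/(ltn a).
by case: ifP => // /negbT; rewrite -has_find => /insert_row_max ->.
Qed.

(** The bumped entry [b] never moves to the right, since the entry of [R'] above it, if any, exceeds
    it. Below its new place stands [a] or an entry to the left of [a], hence at most [a < b]. In the
    column where [a] replaces [b], the lower entry only decreases. *)
Lemma dominates_insert_row a R R' :
    dominates R R' -> has (ltn a) R ->
  dominates (insert_row a R) (insert_row (nth 0 R (find (ltn a) R)) R').
Proof.
move=> [le_size ltRR'] has_a; set j := find _ R; set b := nth 0 R j.
have jR : j < size R by rewrite -has_find.
have ab : a < b := nth_find 0 has_a.
have j'j : find (ltn b) R' <= j.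
  have [jR'|] := ltnP j (size R'); last exact: leq_trans (find_size _ _).
  rewrite leqNgt; apply/negP => /(before_find 0) /=.
  by rewrite ltRR'.
rewrite /insert_row -/j; set j' := find _ R' in j'j *.
have j'R := leq_ltn_trans j'j jR.
split=> [|i]; rewrite !size_set_nth.
  by rewrite (maxn_idPr jR) geq_max j'R.
have le_Ra k : k < j -> nth 0 R k <= a.
  by move=> /(before_find 0) /= /negbT; rewrite -leqNgt.
rewrite !nth_set_nth /= leq_max ltnS => lt_i.
have [eij' | ne_ij'] := eqVneq i j'.
  have [// | ne_ij] := eqVneq i j.
  by apply: leq_ltn_trans ab; rewrite le_Ra // ltn_neqAle ne_ij eij'.
have lt_iR : i < size R'.
  case/orP: lt_i => // le_ij'; apply: leq_trans (find_size (ltn b) R').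
  by rewrite ltn_neqAle ne_ij'.
case: eqP => [eij | _]; last exact: ltRR'.
by apply: ltn_trans ab _; rewrite /b -eij ltRR'.
Qed.

Lemma tab_insert_cons a R S : tab_insert a (R :: S) =
  if has (ltn a) R then
    let Sk := tab_insert (nth 0 R (find (ltn a) R)) S in
    (insert_row a R :: Sk.1, Sk.2.+1)
  else (insert_row a R :: S, 0).
Proof.
by rewrite /= row_insertE; case: has => //; case: (tab_insert _ S).
Qed.

Lemma head_tab_insert a S :
  head [::] (tab_insert a S).1 = insert_row a (head [::] S).
Proof. by case: S => // R S; rewrite tab_insert_cons; case: has. Qed.

Lemma shape_tab_insert a S :
  shape (tab_insert a S).1 = incr_nth (shape S) (tab_insert a S).2.
Proof.
elim: S a => // R S IHS a; rewrite tab_insert_cons.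
case: ifP => [|R_le] /=.
  by rewrite has_find => lt_R; rewrite IHS size_set_nth (maxn_idPr lt_R).
by rewrite insert_row_max ?R_le // size_rcons.
Qed.

Lemma shape_add_box T k i : shape (add_box T k i) = incr_nth (shape T) k.
Proof.
rewrite /add_box; elim: T k => [|R T IHT] [|k] //=; last by rewrite IHT.
  by elim: k => //= k [->].
by rewrite size_rcons.
Qed.

Lemma column_strict_tab_insert a S :
  column_strict S -> column_strict (tab_insert a S).1.
Proof.
elim: S a => [|R S IHS] a; first by move=> _ [|i]; rewrite /= ?nth_nil.
rewrite tab_insert_cons => /column_strict_cons[dR cS].
case: ifP => [has_a | R_le] /=; apply/column_strict_cons.
  by rewrite head_tab_insert; split; [apply: dominates_insert_row | apply: IHS].
split=> //; case: dR => le_size ltR; rewrite insert_row_max ?R_le //.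
split=> [|j jR']; first by rewrite size_rcons ltnW.
by rewrite nth_rcons (leq_trans jR') ?ltR.
Qed.

Lemma shape_gt0_tab_insert a S :
  0 \notin shape S -> 0 \notin shape (tab_insert a S).1.
Proof.
elim: S a => // R S IHS a.
rewrite tab_insert_cons /= inE negb_or => /andP[_ S0].
by case: ifP; rewrite /= inE negb_or size_set_nth eq_sym -lt0n leq_max ?IHS.
Qed.

(** * Standard tableaux *)

Record standard (T : tableau) : Prop := Standard {
  standard_rows : all (sorted ltn) T;
  standard_columns : column_strict T;
  standard_nonempty : 0 \notin shape T }.

Lemma nth_add_box T k i p :
  nth [::] (add_box T k i) p =
  if p == k then rcons (nth [::] T k) i else nth [::] T p.
Proof. by rewrite nth_set_nth. Qed.

Lemma nth_nth_lt T m p j :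
    all (gtn m) (flatten T) -> j < size (nth [::] T p) ->
  nth 0 (nth [::] T p) j < m.
Proof.
move=> T_m jT; have pT : p < size T.
  by rewrite ltnNge; apply: contraL jT => le_p; rewrite nth_default.
apply: (allP T_m); apply/flattenP; exists (nth [::] T p); exact: mem_nth.
Qed.

Lemma standard_add_box T k m :
    standard T -> all (gtn m) (flatten T) ->
    0 \notin shape (add_box T k m) -> sorted geq (shape (add_box T k m)) ->
  standard (add_box T k m).
Proof.
move=> [sT cT T0] T_m T'0 T'_partition; split=> //.
  apply/(all_nthP [::]) => p _; rewrite nth_add_box.
  have sorted_nth q : sorted ltn (nth [::] T q).
    have [qT|?] := ltnP q (size T); last by rewrite nth_default.
    exact: (all_nthP [::] sT).
  case: eqP => // _; have := sorted_nth k.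
  have : all (gtn m) (nth [::] T k).
    by apply/(all_nthP 0) => j; apply: nth_nth_lt.
  case: (nth _ T k) => //= x R /andP[xm R_m] xR; rewrite rcons_path xR /=.
  by have := mem_last x R; rewrite inE => /orP[/eqP->//|/(allP R_m)].
move=> p.
have le_size : size (nth [::] (add_box T k m) p.+1)
               <= size (nth [::] (add_box T k m) p).
  rewrite -!nth_shape.
  have [lt_p|?] := ltnP p.+1 (size (shape (add_box T k m))).
    by have /(sortedP 0)/(_ p lt_p) := T'_partition.
  by rewrite nth_default.
split=> // j; case: (cT p) => le_sizeT ltT.
move: le_size; rewrite !nth_add_box.
(* If the new box is in the upper row, [le_size] provides a box below it, whose entry is smaller
   than [m]. *)
have [<- | _] := eqVneq p.+1 k.
  rewrite ltn_eqF // size_rcons ltnS => lt_size; rewrite leq_eqVlt nth_rcons.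
  move=> /orP[/eqP->|lt_j]; last by rewrite lt_j ltT.
  by rewrite ltnn eqxx nth_nth_lt.
move=> _ lt_j; have lt_j' := leq_trans lt_j le_sizeT.
by case: eqP => [<-|_]; rewrite ?nth_rcons ?lt_j' ltT.
Qed.

Lemma RSK_step_pair S T i a : RSK_step (S, T) (i, a) =
  ((tab_insert a S).1, add_box T (tab_insert a S).2 i).
Proof. by rewrite /RSK_step /=; case: tab_insert. Qed.

(** The recording tableau gets its partition shape from the insertion tableau, whose columns stay
    strict. Each new label [m] exceeds all earlier ones. *)
Lemma standard_RSK w : standard (RSK w).2.
Proof.
pose good m (ST : tableau * tableau) :=
  [/\ column_strict ST.1, standard ST.2, shape ST.1 = shape ST.2
    & all (gtn m) (flatten ST.2)].
have step s m ST : good m ST ->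
    good (m + size s) (foldl RSK_step ST (zip (iota m (size s)) s)).
  elim: s m ST => [|a s IHs] m [S T]; first by rewrite addn0.
  case=> /= cS sT eq_sh T_m; rewrite -addSnnS; apply: IHs.
  rewrite RSK_step_pair; set k := (tab_insert a S).2.
  have eq_sh' : shape (tab_insert a S).1 = shape (add_box T k m).
    by rewrite shape_tab_insert shape_add_box eq_sh.
  have cS' := column_strict_tab_insert a S cS.
  split=> //=.
    apply: standard_add_box; rewrite // -eq_sh'.
      by rewrite shape_gt0_tab_insert // eq_sh standard_nonempty.
    exact: shape_column_strict.
  rewrite (perm_all _ (perm_add_box _ _ _)) /= ltnSn.
  by apply: sub_all T_m => x /=; apply: leqW.
have nil_strict : column_strict [::] by move=> i; rewrite !nth_nil.
by have [] := step w 1 ([::], [::]).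
Qed.

(** * The reversed reading word *)

Fixpoint add_column (P : tableau) (c : seq nat) : tableau :=
  if c is x :: c' then rcons (head [::] P) x :: add_column (behead P) c' else P.

(** Built column by column, in the order in which insertion of the reversed reading word produces
    it. *)
Definition transpose (T : tableau) : tableau := foldl add_column [::] T.

Lemma nth_add_column P c p : nth [::] (add_column P c) p =
  if p < size c then rcons (nth [::] P p) (nth 0 c p) else nth [::] P p.
Proof.
elim: c P p => [|x c IHc] P [|p] //=.
by rewrite ltnS IHc; case: P => //=; rewrite nth_nil.
Qed.

(** Serves the recording tableau, which gains the boxes of a new column one at a time from the
    bottom up. *)
Lemma add_box_column P c x :
  add_box (add_column P c) (size c) x = add_column P (rcons c x).
Proof.
rewrite /add_box; elim: c P => [|y c IHc] P /=; first by case: P.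
by rewrite IHc.
Qed.

Lemma size_nth_transpose T p :
  size (nth [::] (transpose T) p) = count (ltn p) (shape T).
Proof.
suff size_foldl P : size (nth [::] (foldl add_column P T) p) =
    size (nth [::] P p) + count (ltn p) (shape T).
  by rewrite size_foldl nth_nil.
elim: T P => [|c T IHT] P /=; first by rewrite addn0.
rewrite IHT nth_add_column addnA; case: (p < size c); last by rewrite addn0.
by rewrite size_rcons addn1.
Qed.

(** This ensures that a letter of [c] reaching its row bumps no entry of [P]. *)
Definition left_of (P : tableau) (c : seq nat) : Prop :=
  forall p, p < size c -> all (geq (nth 0 c p)) (nth [::] P p).

Lemma left_of_nil c : left_of [::] c.
Proof. by move=> p _; rewrite nth_nil. Qed.

Lemma left_of_add_column P c c' :
  left_of P c -> dominates c c' -> left_of (add_column P c) c'.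
Proof.
move=> Pc [le_size lt_cc'] p lt_p; have lt_p' := leq_trans lt_p le_size.
rewrite nth_add_column lt_p' all_rcons /= ltnW ?lt_cc' //.
by apply: sub_all (Pc p lt_p') => x /= /leq_trans; apply; rewrite ltnW ?lt_cc'.
Qed.

Lemma row_insert_max a R :
  all (geq a) R -> row_insert a R = (rcons R a, None).
Proof.
move=> R_le; have hasN : ~~ has (ltn a) R.
  by apply/hasPn => x /(allP R_le) /=; rewrite -leqNgt.
by rewrite row_insertE (negbTE hasN) insert_row_max.
Qed.

Lemma row_insert_rcons a b R :
  all (geq a) R -> a < b -> row_insert a (rcons R b) = (rcons R a, Some b).
Proof.
move=> R_le ab; rewrite row_insertE has_rcons /= ab /=.
elim: R R_le => [|x R IHR]; first by rewrite /= insert_row_cons ab.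
move=> /= /andP[xa /IHR[eqR eqb]].
by rewrite insert_row_cons [a < x]ltnNge xa /= eqR eqb.
Qed.

(** The letter [x] bumps the bottom entry of the last column, which then does the same one row
    higher, in [behead P]. The top letter of the column opens the new box, in row [size s]. *)
Lemma tab_insert_add_column x s P :
    sorted ltn (x :: s) -> left_of P (x :: s) ->
  tab_insert x (add_column P s) = (add_column P (x :: s), size s).
Proof.
elim: s x P => [|y s IHs] x P.
  by move=> _ /(_ 0 isT); case: P => [|R P] //= /row_insert_max ->.
move=> /andP[xy s_sorted] Pc.
have headP : all (geq x) (head [::] P) by rewrite -nth0; apply: (Pc 0).
rewrite /= row_insert_rcons // IHs // => p lt_p.
by rewrite nth_behead; apply: (Pc p.+1).
Qed.

Lemma foldl_RSK_rev P Q m c :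
    sorted ltn c -> left_of P c ->
  foldl RSK_step (P, Q) (zip (iota m (size c)) (rev c)) =
    (add_column P c, add_column Q (iota m (size c))).
Proof.
elim: c => // x c IHc c_sorted Pc.
(* Before [x] arrives, the letters of [c] sit one row lower; row [p] of [P] is bounded by entry [p]
   of [x :: c], which is smaller than entry [p.+1]. *)
have Pc' : left_of P c.
  move=> p lt_p; apply: sub_all (Pc p (ltnW lt_p)) => z /= /leq_trans; apply.
  have /(sortedP 0)/(_ p) /= := c_sorted; rewrite ltnS => /(_ lt_p).
  exact: ltnW.
rewrite rev_cons [size (_ :: _)]/= -addn1 iotaD -cats1.
rewrite zip_cat ?size_iota ?size_rev // foldl_cat.
rewrite IHc ?(path_sorted c_sorted) //.
rewrite [foldl _ _ _]/= RSK_step_pair tab_insert_add_column //=.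
by rewrite -[X in add_box _ X](size_iota m) add_box_column cats1.
Qed.

Lemma reversed_reading_wordE T :
  reversed_reading_word T = flatten (map rev T).
Proof.
by rewrite /reversed_reading_word /reading_word rev_flatten map_rev revK.
Qed.

Definition row_superstandard (la : seq nat) : tableau :=
  reshape la (iota 1 (sumn la)).

Lemma shape_row_superstandard la : shape (row_superstandard la) = la.
Proof. by rewrite reshapeKl ?size_iota. Qed.

Lemma RSK_reversed_reading_word T : standard T ->
  RSK (reversed_reading_word T) =
    (transpose T, transpose (row_superstandard (shape T))).
Proof.
case=> sT cT _.
(* Generalised over the tableaux built so far and the next label. The condition concerns the next
   row only; strict columns carry it on to the following one. *)
suff insert_rows m P Q : left_of P (head [::] T) ->
    foldl RSK_step (P, Q)
      (zip (iota m (sumn (shape T))) (flatten (map rev T))) =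
    (foldl add_column P T,
     foldl add_column Q (reshape (shape T) (iota m (sumn (shape T))))).
  rewrite /RSK (perm_size (perm_reversed_reading_word T)) size_flatten.
  rewrite reversed_reading_wordE insert_rows //; exact: left_of_nil.
elim: T sT cT m P Q => // c T IHT /andP[sc sT] /column_strict_cons[dc cT].
move=> m P Q Pc.
rewrite /= iotaD zip_cat ?size_iota ?size_rev // foldl_cat foldl_RSK_rev //.
rewrite IHT //; last exact: left_of_add_column dc.
by rewrite take_size_cat ?drop_size_cat ?size_iota.
Qed.

Theorem theorem4p8 (n : nat) (hn : 1 <= n) (pi : permword n) :
  exists2 k, k <= 2 & exists2 m, m <= 2 & in_cycle (@r n) m (iter k (@r n) pi).
Proof.
pose T k := (RSK (val (iter k (@r n) pi))).2.
have T_std k : standard (T k) by apply: standard_RSK.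
have TS k : T k.+1 = transpose (row_superstandard (shape (T k))).
  by have /(congr1 snd) := RSK_reversed_reading_word _ (T_std k).
(* [T k.+1] depends only on the shape of [T k] and has the conjugate shape, so [T 2] and [T 0] have
   equal shapes. *)
have T31 : T 3 = T 1.
  rewrite (TS 2) (TS 0); congr (transpose (row_superstandard _)).
  have shapeTS k i : nth 0 (shape (T k.+1)) i = count (ltn i) (shape (T k)).
    by rewrite nth_shape TS size_nth_transpose shape_row_superstandard.
  have [_ c0 n0] := T_std 0; have [_ c1 _] := T_std 1; have [_ _ n2] := T_std 2.
  by apply: conjugate_partitionK (shapeTS 0) (shapeTS 1) => //;
    apply: shape_column_strict.
(* The index shifts by one: [iter k.+1] is the reversed reading word of [T k]. *)
have r4 : iter 4 (@r n) pi = iter 2 (@r n) pi.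
  by apply: val_inj; rewrite /= -/(T 3) -/(T 1) T31.
exists 2 => //; set rho := iter 2 _ pi in r4 *.
(* As [r (r rho) = rho], the minimal period is 1 or 2 according to whether [rho] is fixed. *)
have [fix_rho | nfix] := eqVneq (val (r rho)) (val rho).
  exists 1 => //; split=> //; first exact: val_inj.
  by case=> // j; rewrite ltnNge.
exists 2 => //; split=> // -[|[|j]] //= _ eq_rho.
by rewrite eq_rho eqxx in nfix.
Qed.
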